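(* Let $v_1,\ldots,v_m\in\mathbb{N}^s$, $\mathcal{P}=\mathrm{conv}(v_1,\ldots,v_m)$, and let $w=w_1\cdots w_p$ be any monomial of degree $p$ in $t_1,\ldots,t_s$, with $w_i\in\{t_1,\ldots,t_s\}$ for $i=1,\ldots,p$. If $w_i\not\equiv0$ on $\mathcal{P}$ for $i\le r$ and $w_i\equiv0$ on $\mathcal{P}$ for $i>r$, then $$\dim(\mathcal{P}_w)=\deg(E_{\mathcal{P}_w})=\dim(\mathcal{P})+r.$$
   Context: $\mathbb{N}=\{0,1,2,\ldots\}$. Each variable $t_i$ is viewed as the $i$-th coordinate function on $\mathbb{R}^s$. The $r$-weight lifting polytope (the letter $r$ here names the construction) is $\mathcal{P}_w=\mathrm{conv}(\mathcal{G})\subset\mathbb{R}^{s+p}$, where $\mathcal{G}=\{(v_i,0)+w_{j_1}(v_i)e_{s+j_1}+\cdots+w_{j_k}(v_i)e_{s+j_k}\mid1\le i\le m,\ 1\le j_1<\cdots<j_k\le p\}$, with $k=0$ allowed (giving $(v_i,0)\in\mathcal{G}$), and $e_j$ are unit vectors. $E_{\mathcal{Q}}(n)=|n\mathcal{Q}\cap\mathbb{Z}^N|$ is the Ehrhart polynomial of a lattice polytope $\mathcal{Q}\subset\mathbb{R}^N$. *)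

(* Defs.v *)
From HB Require Import structures.
From mathcomp Require Import all_boot all_order all_algebra.
From mathcomp Require Import all_classical all_reals.
From mathcomp Require Import finmap convex.

Set Implicit Arguments.
Unset Strict Implicit.
Unset Printing Implicit Defensive.

Import Order.TTheory GRing.Theory Num.Theory.
Local Open Scope classical_set_scope.
Local Open Scope ring_scope.

Definition conv_hull (R : realType) (N : nat) (A : set 'rV[R]_N) :
    set 'rV[R]_N :=
  smallest (@convex_set R 'rV[R]_N) A.

Definition affine_set (R : realType) (N : nat) (A : set 'rV[R]_N) : Prop :=
  forall (x y : 'rV[R]_N) (t : R), A x -> A y -> A (t *: x + (1 - t) *: y).

Definition affine_hull (R : realType) (N : nat) (A : set 'rV[R]_N) :
    set 'rV[R]_N :=
  smallest (@affine_set R N) A.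

(* The linear subspace U such that the affine hull of A is a translate of U.
   It exists and is unique when A is nonempty; the default 0 is only reached
   for A empty. *)
Definition direction (R : realType) (N : nat) (A : set 'rV[R]_N) :
    {vspace 'rV[R]_N} :=
  xget 0%VS [set U : {vspace 'rV[R]_N} |
    exists a : 'rV[R]_N, affine_hull A = [set a + u | u in [set` U]]].

Definition polytope_dim (R : realType) (N : nat) (A : set 'rV[R]_N) : nat :=
  \dim (direction A).

Definition integer_points (R : realType) (N : nat) : set 'rV[R]_N :=
  [set x | forall i, x 0 i \is a Num.int].
Arguments integer_points : clear implicits.

(* |nQ \cap Z^N|. This set is finite as soon as Q is bounded; fset_set returns
   the empty finite set on infinite sets. *)
Definition lattice_count (R : realType) (N : nat) (Q : set 'rV[R]_N)
    (n : nat) : nat :=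
  #|` fset_set ([set n%:R *: x | x in Q] `&` integer_points R N)|%fset.

(* At most one E satisfies this; Ehrhart's theorem gives one for every
   nonempty lattice polytope Q. *)
Definition is_ehrhart_polynomial (R : realType) (N : nat) (Q : set 'rV[R]_N)
    (E : {poly rat}) : Prop :=
  forall n : nat, E.[n%:R] = (lattice_count Q n)%:R.

Definition real_point (R : realType) (s : nat) (a : 'rV[nat]_s) : 'rV[R]_s :=
  map_mx (fun k : nat => k%:R) a.

Definition lattice_polytope (R : realType) (s m : nat)
    (v : 'I_m -> 'rV[nat]_s) : set 'rV[R]_s :=
  conv_hull (range (fun i => real_point R (v i))).
Arguments lattice_polytope R {s m} v.

(* A factorization w = w_1 ... w_p into variables is encoded by the map
   w : 'I_p -> 'I_s with w_j = t_(w j), so that w_j(x) = x 0 (w j). The index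
   sequences j_1 < ... < j_k are the subsets J of 'I_p. *)
Definition lifted_point (R : realType) (s p : nat) (w : 'I_p -> 'I_s)
    (a : 'rV[R]_s) (J : {set 'I_p}) : 'rV[R]_(s + p) :=
  row_mx a 0 + \sum_(j in J) a 0 (w j) *: delta_mx 0 (rshift s j).

Definition weight_lifting_polytope (R : realType) (s p m : nat)
    (w : 'I_p -> 'I_s) (v : 'I_m -> 'rV[nat]_s) : set 'rV[R]_(s + p) :=
  conv_hull [set g | exists (i : 'I_m) (J : {set 'I_p}),
    g = lifted_point w (real_point R (v i)) J].
Arguments weight_lifting_polytope R {s p m} w v.

(* Main.v *)
Require Import Defs.
From HB Require Import structures.
From mathcomp Require Import all_boot all_order all_algebra.
From mathcomp Require Import all_classical all_reals.
From mathcomp Require Import finmap interval_inference convex lra ring.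
From mathcomp.real_closed Require polyrcf.

Set Implicit Arguments.
Unset Strict Implicit.
Unset Printing Implicit Defensive.

Import Order.TTheory GRing.Theory Num.Theory.
Local Open Scope classical_set_scope.
Local Open Scope ring_scope.

(** The two equalities have separate reasons.

    Dimension.  The affine hull of the convex hull of finitely many points g t
    is g t0 plus the span of the differences g t - g t0, so the direction of
    such a polytope is that span (direction_conv_hull).  For the lifted points
    with base point (v_i0, 0), taking J empty gives the embedded differences
    (v_i - v_i0, 0); and when w_j does not vanish on P it does not vanish at
    some v_i, where the lifted points for J = {j} and for J empty differ
    by the nonzero multiple w_j(v_i) e_(s+j).  Coordinates with w_j = 0 on P
    contribute nothing.  So the direction of P_w is the embedded direction of P
    plus the span of r unit vectors (span_lifted_family), a direct sum of
    dimension dim P + r.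

    Degree.  For a lattice polytope Q of dimension d, the number of lattice
    points of nQ has order n^d, at least along the multiples n of d+1, and this
    forces the degree of a polynomial that computes it.
    From above, some d coordinates separate the points of the direction of Q
    (separating_coordinates), so lattice points of nQ are determined by d
    integers of size O(n) (lattice_count_le).  From below, d linearly
    independent differences y_i = g t_i - g t0 of lattice generators give the
    (k+1)^d distinct points n (g t0) + sum_i a_i y_i with 0 <= a_i <= k, and they
    lie in nQ for n = (d+1)k (lattice_count_ge).  A polynomial squeezed between
    k^d and (Ck)^d at all positive integers k has degree d, as the leading
    coefficients of the two nonnegative gaps show (size_poly_growth). *)

(** * Affine hulls of finitely generated polytopes *)

Section Affine.
Variables (R : realType) (N : nat).
Implicit Types (A : set 'rV[R]_N) (U : {vspace 'rV[R]_N}).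

Lemma convex_setP A :
  @convex_set R 'rV[R]_N A <->
  forall (x y : 'rV[R]_N) (t : R), 0 <= t -> t <= 1 -> A x -> A y ->
    A (t *: x + (1 - t) *: y).
Proof.
split=> [cA x y t t0 t1 Ax Ay | cA x y t].
  exact: (set_mem (cA x y (Itv01 t0 t1) (mem_set Ax) (mem_set Ay))).
move=> /set_mem Ax /set_mem Ay; apply/mem_set.
by apply: cA.
Qed.

Lemma conv_hull_convex A (x y : 'rV[R]_N) (t : R) :
  0 <= t -> t <= 1 -> conv_hull A x -> conv_hull A y ->
  conv_hull A (t *: x + (1 - t) *: y).
Proof.
move=> t0 t1 Ax Ay B [cB AB]; have /convex_setP := cB; apply => //.
  exact: Ax.
exact: Ay.
Qed.

Lemma affine_set_convex A : affine_set A -> @convex_set R 'rV[R]_N A.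
Proof. by move=> aA; apply/convex_setP => x y t _ _; apply: aA. Qed.

Lemma translate_affine (a : 'rV[R]_N) U :
  affine_set [set a + u | u in [set` U]].
Proof.
move=> _ _ t [u /= uU <-] [u' /= u'U <-].
exists (t *: u + (1 - t) *: u'); first by rewrite /= rpredD ?rpredZ.
rewrite !scalerDr addrACA -scalerDl; congr (_ + _).
by rewrite addrC subrK scale1r.
Qed.

(** Makes the subspace selected by [direction] unique. *)
Lemma translate_inj (a b : 'rV[R]_N) (U V : {vspace 'rV[R]_N}) :
  [set a + u | u in [set` U]] = [set b + u | u in [set` V]] -> U = V.
Proof.
suff sub (c d : 'rV[R]_N) (W W' : {vspace 'rV[R]_N}) :
    [set c + u | u in [set` W]] = [set d + u | u in [set` W']] -> (W <= W')%VS.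
  move=> E; apply/eqP; rewrite eqEsubv (sub _ _ _ _ E).
  by rewrite (sub _ _ _ _ (esym E)).
move=> E; apply/subvP => u uW.
have mem z : z \in W -> exists2 z', z' \in W' & c + z = d + z'.
  move=> zW; have : [set d + u | u in [set` W']] (c + z) by rewrite -E; exists z.
  by case=> z' z'W' <-; exists z'.
have [z zW' ze] := mem _ uW; have [z0 z0W' z0e] := mem _ (mem0v W).
have -> : u = z - z0.
  by rewrite -[u](addKr c) ze -[c]addr0 z0e opprD addrACA addNr add0r addrC.
exact: rpredB.
Qed.

(** Up to the translation by x0, an affine set through x0 is closed under
    scaling (combine with x0) and under addition (double the midpoint), hence
    under linear combinations. *)
Lemma affine_span (B : set 'rV[R]_N) (x0 : 'rV[R]_N) (X : seq 'rV[R]_N) :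
  affine_set B -> B x0 -> (forall x, x \in X -> B (x0 + x)) ->
  forall u, u \in <<X>>%VS -> B (x0 + u).
Proof.
move=> aB B0.
have Bscale c u : B (x0 + u) -> B (x0 + c *: u).
  move=> Bu; have := aB _ _ c Bu B0.
  rewrite scalerDr addrAC -scalerDl addrC [c + _]addrC subrK scale1r.
  by rewrite addrC.
elim: X => [|x X IH] BX u.
  by rewrite span_nil memv0 => /eqP ->; rewrite addr0.
rewrite span_cons => /memv_addP[_ /vlineP[c ->] [z zX ->]].
(* The factors 2 cancel the weight 1/2 of the midpoint taken at the end. *)
have Bx : B (x0 + (2 * c) *: x) by apply/Bscale/BX; rewrite mem_head.
have Bz : B (x0 + 2 *: z).
  by apply/Bscale/IH => // y yX; apply: BX; rewrite inE yX orbT.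
have := aB _ _ (2^-1) Bx Bz.
congr B; apply/rowP => i; rewrite !mxE; by field.
Qed.

Section Family.
Variables (T : finType) (g : T -> 'rV[R]_N) (t0 : T).

Definition differences : seq 'rV[R]_N := [seq g t - g t0 | t <- enum T].

Lemma affine_hull_conv_hull :
  affine_hull (conv_hull (range g)) =
  [set g t0 + u | u in [set` <<differences>>%VS]].
Proof.
have rangeS : range g `<=` [set g t0 + u | u in [set` <<differences>>%VS]].
  move=> _ [t _ <-]; exists (g t - g t0); last by rewrite addrC subrK.
  by apply: memv_span; apply: map_f; rewrite mem_enum.
apply/seteqP; split.
  apply: smallest_sub; first exact: translate_affine.
  apply: smallest_sub => //.
  exact/affine_set_convex/translate_affine.
move=> _ [u /= uD <-] B [aB hB].
have Bg t : B (g t) by apply: hB => C [_]; apply; exists t.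
apply: (affine_span aB) uD => // _ /mapP[t _ ->].
by rewrite addrC subrK.
Qed.

Lemma direction_conv_hull :
  direction (conv_hull (range g)) = <<differences>>%VS.
Proof.
rewrite /direction; case: xgetP => [U _ [a]|].
  by rewrite affine_hull_conv_hull => /translate_inj.
by move=> /(_ <<differences>>%VS); case; exists (g t0); apply: affine_hull_conv_hull.
Qed.

Lemma conv_hull_sub_direction x y :
  conv_hull (range g) x -> conv_hull (range g) y ->
  x - y \in direction (conv_hull (range g)).
Proof.
rewrite direction_conv_hull => gx gy.
have sub : conv_hull (range g) `<=` [set g t0 + u | u in [set` <<differences>>%VS]].
  by rewrite -affine_hull_conv_hull; apply: sub_gen_smallest.
have [u uD <-] := sub _ gx; have [u' u'D <-] := sub _ gy.
by rewrite opprD addrACA subrr add0r rpredB.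
Qed.

End Family.
End Affine.

(** * Polynomials of prescribed growth *)

(** Otherwise [- p] would eventually stay above its positive leading
    coefficient. *)
Lemma lead_coef_ge0 (F : realFieldType) (p : {poly F}) :
  (forall b, exists2 x, b <= x & 0 <= p.[x]) -> 0 <= lead_coef p.
Proof.
move=> hp; rewrite leNgt; apply/negP => lp.
have [|b hb] := @polyrcf.poly_pinfty_gt_lc F (- p); first by rewrite lead_coefN oppr_gt0.
have [x /hb] := hp b; rewrite hornerN lead_coefN lerN2 => le ge.
by have := le_lt_trans (le_trans ge le) lp; rewrite ltxx.
Qed.

(** Both gaps [p - 'X^d] and [C ^ d *: 'X^d - p] have nonnegative leading
    coefficients.  If [p] had degree less than [d], the first of these would be
    [-1]; if [p] had degree more than [d], the second would be [- lead_coef p],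
    which is negative because [p] is nonnegative at positive integers. *)
Lemma size_poly_growth (F : archiRealFieldType) (p : {poly F}) (C d : nat) :
  (forall k, (0 < k)%N -> k%:R ^+ d <= p.[k%:R] <= (C * k)%:R ^+ d) ->
  size p = d.+1.
Proof.
move=> hp.
have lead_ge0 (q : {poly F}) :
    (forall k, (0 < k)%N -> 0 <= q.[k%:R]) -> 0 <= lead_coef q.
  move=> hq; apply: lead_coef_ge0 => b; exists (Num.bound `|b|)%:R; last exact: hq.
  exact: le_trans (ler_norm b) (ltW (archi_boundP (normr_ge0 b))).
have lp : 0 <= lead_coef p.
  apply: lead_ge0 => k /hp/andP[le _]; apply: le_trans le.
  by rewrite exprn_ge0.
have l1 : 0 <= lead_coef (p - 'X^d).
  by apply: lead_ge0 => k /hp/andP[le _]; rewrite !hornerE subr_ge0.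
have l2 : 0 <= lead_coef (C%:R ^+ d *: 'X^d - p).
  by apply: lead_ge0 => k /hp/andP[_ le]; rewrite !hornerE subr_ge0 -exprMn -natrM.
apply/eqP; rewrite eqn_leq; apply/andP; split; rewrite leqNgt; apply/negP => sp.
  move: l2; rewrite addrC lead_coefDl; last first.
    by rewrite size_polyN (leq_ltn_trans (size_scale_leq _ _)) // size_polyXn.
  rewrite lead_coefN oppr_ge0 => lp'.
  have /eqP : lead_coef p == 0 by rewrite eq_le lp lp'.
  by move/eqP; rewrite lead_coef_eq0 => /eqP p0; rewrite p0 size_poly0 in sp.
move: l1; rewrite addrC lead_coefDl ?size_polyN ?size_polyXn //.
by rewrite lead_coefN lead_coefXn oppr_ge0 ler10.
Qed.

(** * Coordinates and bases of subspaces of row vectors *)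

Section LinearAlgebra.
Variables (F : fieldType) (N : nat).

Lemma row_free_basis d (X : d.-tuple 'rV[F]_N) :
  free X -> row_free (\matrix_(i < d) X`_i).
Proof.
move=> /freeP fX; apply: inj_row_free => c; rewrite mulmx_sum_row => cX.
apply/rowP => i; rewrite mxE.
apply: (fX (c 0)); apply: etrans cX.
by apply: eq_bigr => j _; rewrite rowK.
Qed.

(** A matrix whose rows form a basis of [U] has rank [\dim U], hence an
    invertible submatrix on [\dim U] of its columns; those columns will do. *)
Lemma separating_coordinates (U : {vspace 'rV[F]_N}) :
  exists f : 'I_(\dim U) -> 'I_N,
    forall u, u \in U -> (forall i, u 0 (f i) = 0) -> u = 0.
Proof.
pose B := \matrix_(i < \dim U) (vbasis U)`_i.
have fullB : row_full B^T.
  rewrite /row_full mxrank_tr -/(row_free B).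
  exact: row_free_basis (basis_free (vbasisP U)).
exists (fullrankfun fullB) => u uU u0.
pose c := \col_i coord (vbasis U) i u.
have c0 : c = 0.
  apply: (can_inj (mulKmx (fullrowsub_unit fullB))); rewrite mulmx0.
  apply/colP => i; rewrite !mxE -[RHS](u0 i) [in RHS](coord_vbasis uU) summxE.
  by apply: eq_bigr => j _; rewrite !mxE mulrC.
rewrite (coord_vbasis uU) big1 // => i _.
by have /colP/(_ i) := c0; rewrite !mxE => ->; rewrite scale0r.
Qed.

(** Unlike [vbasis], the basis is taken among the given generators; this is what
    keeps it integral in the lattice point count. *)
Lemma span_free_subfamily (X : seq 'rV[F]_N) :
  exists Y : (\dim <<X>>).-tuple 'rV[F]_N, {subset Y <= X} /\ free Y.
Proof.
suff [Y [YX fY sY]] : exists Y, [/\ {subset Y <= X}, free Y & <<Y>>%VS = <<X>>%VS].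
  have sz : size Y == \dim <<X>> by rewrite -sY eq_sym; move: fY; rewrite /free.
  by exists (Tuple sz).
elim: X => [|x X [Y [YX fY sY]]]; first by exists [::]; rewrite nil_free.
have [xY|xY] := boolP (x \in <<Y>>%VS).
  exists Y; split => //; first by move=> y /YX yX; rewrite inE yX orbT.
  rewrite span_cons -sY; apply/esym/addv_idPr.
  by rewrite -memvE.
exists (x :: Y); split.
- by move=> y; rewrite !inE => /orP[->//|/YX ->]; rewrite orbT.
- by rewrite free_cons xY.
- by rewrite !span_cons sY.
Qed.
End LinearAlgebra.

(** * Growth of the number of lattice points *)

Section Cardinality.
Variables (X : choiceType) (T : finType) (A : set X).

Lemma finite_set_inj (h : X -> T) : {in A &, injective h} -> finite_set A.
Proof. by move=> /inj_card_eq /eq_finite_set <-; apply: finite_finset. Qed.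

Lemma card_fset_set_le (h : X -> T) :
  {in A &, injective h} -> (#|` fset_set A|%fset <= #|T|)%N.
Proof.
move=> hi; have fA := finite_set_inj hi.
rewrite -(size_map h) cardE; apply: uniq_leq_size; last by move=> t _; rewrite mem_enum.
rewrite map_inj_in_uniq ?fset_uniq // => x y.
by rewrite !in_fset_set //; apply: hi.
Qed.

Lemma card_fset_set_ge (h : T -> X) :
  finite_set A -> injective h -> (forall t, A (h t)) ->
  (#|T| <= #|` fset_set A|%fset)%N.
Proof.
move=> fA hi hA; rewrite cardE -(size_map h); apply: uniq_leq_size.
  by rewrite map_inj_uniq ?enum_uniq.
by move=> _ /mapP[t _ ->]; rewrite in_fset_set //; apply: mem_set.
Qed.
End Cardinality.

Section Counting.
Variables (R : realType) (N : nat) (T : finType) (g : T -> 'rV[R]_N) (t0 : T).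
Hypothesis g_int : forall t, integer_points R N (g t).

Let Q := conv_hull (range g).
Let d := polytope_dim Q.

Lemma conv_hull_bounded :
  exists M : nat, forall x, Q x -> forall i, `|x 0 i| <= M%:R.
Proof.
pose B := \sum_t \sum_i `|g t 0 i|.
exists (Num.bound B) => x Qx i.
have B0 : 0 <= B by rewrite !sumr_ge0 // => t _; rewrite sumr_ge0.
have gB t : `|g t 0 i| <= (Num.bound B)%:R.
  apply: le_trans (ltW (archi_boundP B0)).
  rewrite /B (bigD1 t) //= (bigD1 i) //= -addrA lerDl addr_ge0 ?sumr_ge0 // => t' _.
  by rewrite sumr_ge0.
move: x Qx; apply: smallest_sub; last by move=> _ [t _ <-].
apply/convex_setP => x y t t0' t1 hx hy; rewrite /= !mxE.
rewrite (le_trans (ler_normD _ _)) // !normrM (ger0_norm t0').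
rewrite (@ger0_norm _ (1 - t)) ?subr_ge0 //.
have -> : (Num.bound B)%:R = t * (Num.bound B)%:R + (1 - t) * (Num.bound B)%:R :> R.
  by ring.
by rewrite lerD // ler_wpM2l ?subr_ge0.
Qed.

(** Two points of nQ differ by an element of the direction of Q, so they coincide
    as soon as the d separating coordinates do; each of these is an integer
    between -nM and nM. *)
Lemma lattice_count_le (M : nat) : (forall x, Q x -> forall i, `|x 0 i| <= M%:R) ->
  forall n,
  finite_set ([set n%:R *: x | x in Q] `&` integer_points R N) /\
  (lattice_count Q n <= (2 * (n * M)).+1 ^ d)%N.
Proof.
move=> hM n.
have [f hf] := separating_coordinates (direction Q).
(* Shifting by nM makes the coordinates natural numbers at most 2nM. *)
pose h (x : 'rV[R]_N) : {ffun 'I_d -> 'I_(2 * (n * M)).+1} :=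
  [ffun i => inord (Num.truncn (x 0 (f i) + (n * M)%:R))].
suff hi : {in [set n%:R *: x | x in Q] `&` integer_points R N &, injective h}.
  split; first exact: finite_set_inj hi.
  by apply: leq_trans (card_fset_set_le hi) _; rewrite card_ffun !card_ord.
have hE x i : ([set n%:R *: x | x in Q] `&` integer_points R N) x ->
    x 0 (f i) + (n * M)%:R = (h x i)%:R.
  case=> -[q Qq <-] qint.
  have := hM _ Qq (f i); rewrite ler_norml => /andP[lb ub].
  set y := (n%:R *: q) 0 (f i) + _.
  have y0 : 0 <= y.
    rewrite /y mxE natrM -mulrDr mulr_ge0 // addrC -[q 0 _]opprK subr_ge0; lra.
  have yle : y <= (2 * (n * M))%:R.
    rewrite /y mxE !natrM mulrCA -mulrDr ler_wpM2l //; lra.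
  have ynat : y \is a Num.nat by rewrite natrEint y0 andbT rpredD // natr_int.
  rewrite /h ffunE inordK ?truncnK //.
  by rewrite ltnS -(ler_nat R) truncnK.
move=> x y /set_mem Ax /set_mem Ay hxy.
have [[q Qq qx] _] := Ax; have [[q' Qq' qy] _] := Ay.
apply/eqP; rewrite -subr_eq0; apply/eqP; apply: hf.
  rewrite -qx -qy -scalerBr rpredZ //.
  exact: conv_hull_sub_direction.
move=> i; rewrite !mxE; apply/eqP; rewrite subr_eq0; apply/eqP.
by apply: (addIr ((n * M)%:R : R)); rewrite hE // hE // hxy.
Qed.

(** A sum of k+1 points is k+1 times their barycentre.  The distinguished point
    [x0] keeps the number of points positive when k = 0, a case that occurs for
    polytopes of dimension 0. *)
Lemma conv_hull_sum (k : nat) (x0 : 'rV[R]_N) (z : 'I_k -> 'rV[R]_N) :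
  Q x0 -> (forall i, Q (z i)) ->
  exists2 q, Q q & x0 + \sum_(i < k) z i = k.+1%:R *: q.
Proof.
move=> Qx0; elim: k z => [|k IH] z Qz.
  by exists x0; rewrite // big_ord0 addr0 scale1r.
have [q Qq qe] := IH (fun i => z (widen_ord (leqnSn k) i)) (fun i => Qz _).
pose t : R := k.+1%:R / k.+2%:R.
exists (t *: q + (1 - t) *: z ord_max).
  apply: conv_hull_convex => //; [| |exact: Qz]; first by rewrite divr_ge0.
  by rewrite ler_pdivrMr ?ltr0n // mul1r ler_nat.
rewrite big_ord_recr addrA /= qe scalerDr !scalerA /t mulrBr mulr1 mulrC divfK ?pnatr_eq0 //.
by rewrite -natrB // subSnn scale1r.
Qed.

(** Write (d+1)k g t0 + sum_i a_i y_i as k times the sum of the d+1 points g t0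
    and g t0 + (a_i/k) y_i.  With a_i <= k the latter lie on the segment from
    g t0 to g t_i, so [conv_hull_sum] applies; the extra factor d+1 in the
    dilation is the price for letting the a_i vary independently. *)
Lemma lattice_count_ge (k : nat) :
  finite_set ([set (d.+1 * k)%:R *: x | x in Q] `&` integer_points R N) ->
  (k.+1 ^ d <= lattice_count Q (d.+1 * k))%N.
Proof.
move=> finA.
have dE : d = \dim <<differences g t0>> by rewrite /d /polytope_dim (direction_conv_hull g t0).
have [Y [YX fY]] := span_free_subfamily (differences g t0).
rewrite -dE in Y YX fY.
pose h (a : {ffun 'I_d -> 'I_k.+1}) : 'rV[R]_N :=
  (d.+1 * k)%:R *: g t0 + \sum_(i < d) (a i)%:R *: Y`_i.
have Yg (i : 'I_d) : exists t, Y`_i = g t - g t0.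
  have /YX/mapP[t _ ->] : Y`_i \in Y by rewrite mem_nth // size_tuple.
  by exists t.
have Qg t : Q (g t) by move=> B [_]; apply; exists t.
have <- : #|{ffun 'I_d -> 'I_k.+1}| = (k.+1 ^ d)%N by rewrite card_ffun !card_ord.
apply: (card_fset_set_ge (h := h)) => //.
  move=> a b /addrI/eqP; rewrite -subr_eq0 -sumrB => /eqP ab0.
  have /freeP/(_ (fun i => (a i)%:R - (b i)%:R)) := fY.
  move=> fab; apply/ffunP => i; apply/val_inj/eqP.
  rewrite -(eqr_nat R) -subr_eq0; apply/eqP; apply: fab.
  by rewrite -[RHS]ab0; apply: eq_bigr => j _; rewrite scalerBl.
move=> a; split; last first.
  move=> i; rewrite mxE rpredD //; first by rewrite mxE rpredM ?natr_int //; apply: g_int.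
  rewrite summxE rpred_sum // => j _; rewrite mxE rpredM ?natr_int //.
  by have [t ->] := Yg j; rewrite !mxE rpredB //; apply: g_int.
(* The division by k below excludes k = 0, where all a_i vanish. *)
have [k0|k0] := posnP k.
  exists (g t0) => //; rewrite /h big1 ?addr0 // => i _.
  have /eqP -> : (a i == 0 :> nat)%N by rewrite -leqn0 -k0 -ltnS.
  by rewrite scale0r.
have kR : (k%:R : R) != 0 by rewrite pnatr_eq0 -lt0n.
pose z (i : 'I_d) := g t0 + ((a i)%:R / k%:R) *: Y`_i.
have Qz i : Q (z i).
  have [t Yt] := Yg i; rewrite /z Yt.
  set c := _ / _.
  have -> : g t0 + c *: (g t - g t0) = c *: g t + (1 - c) *: g t0.
    by apply/rowP => j; rewrite !mxE; ring.
  apply: conv_hull_convex; [| |exact: Qg|exact: Qg]; first by rewrite divr_ge0.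
  by rewrite ler_pdivrMr ?ltr0n // mul1r ler_nat -ltnS.
have [q Qq qe] := conv_hull_sum (Qg t0) Qz.
exists q => //; rewrite mulnC natrM -scalerA -qe /z big_split /= sumr_const card_ord.
rewrite addrA -mulrS scalerDr -scaler_nat scalerA -natrM mulnC.
rewrite /h; congr (_ + _); rewrite scaler_sumr.
by apply: eq_bigr => i _; rewrite scalerA mulrC divfK.
Qed.

(** The lower bound holds along the dilations (d+1)k only, so the growth
    criterion is applied to E((d+1)X), which has the degree of E. *)
Lemma size_ehrhart_polynomial (E : {poly rat}) :
  is_ehrhart_polynomial Q E -> size E = d.+1.
Proof.
move=> hE; have [M hM] := conv_hull_bounded.
have -> : size E = size (E \Po (d.+1%:R *: 'X)).
  by rewrite size_comp_poly2 // size_scale ?size_polyX // pnatr_eq0.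
apply: (@size_poly_growth _ _ ((2 * M).+1 * d.+1)) => k k0.
have [fin ub] := lattice_count_le hM (d.+1 * k).
rewrite horner_comp !hornerE -natrM hE -!natrX !ler_nat.
have leq_expl a b : (a <= b)%N -> (a ^ d <= b ^ d)%N.
  by case: (d) => [|d'] // le; rewrite leq_exp2r.
apply/andP; split; first exact: leq_trans (leq_expl _ _ _) (lattice_count_ge fin).
apply: leq_trans ub (leq_expl _ _ _).
have : (0 < d.+1 * k)%N by rewrite muln_gt0.
rewrite -(mulnA _ d.+1 k); move: (d.+1 * k)%N => a a0.
by rewrite [leqRHS]mulSn -addn1 [leqRHS]addnC leq_add // -mulnA [(M * a)%N]mulnC.
Qed.
End Counting.

(** * The direction of the lifted polytope *)

(** In contrapositive form: a coordinate that is not identically zero on a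
    polytope is nonzero at one of its generators. *)
Lemma conv_hull_coord_eq0 (R : realType) (N : nat) (A : set 'rV[R]_N) (k : 'I_N) :
  (forall x, A x -> x 0 k = 0) -> forall x, conv_hull A x -> x 0 k = 0.
Proof.
move=> A0; apply: smallest_sub => //.
by apply/convex_setP => x y t _ _ /= x0 y0; rewrite !mxE x0 y0 !mulr0 addr0.
Qed.

Section Lifting.
Variables (R : realType) (s p r : nat) (hr : (r <= p)%N).

Definition embed : 'Hom('rV[R]_s, 'rV[R]_(s + p)) :=
  linfun (mulmxr (row_mx 1%:M 0)).

Lemma embedE u : embed u = row_mx u 0.
Proof. by rewrite lfunE /= mul_mx_row mulmx1 mulmx0. Qed.

Definition lift_directions : r.-tuple 'rV[R]_(s + p) :=
  [tuple delta_mx 0 (rshift s (widen_ord hr j)) | j < r].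

Lemma lift_directions_free : free lift_directions.
Proof.
apply/freeP => k k0 i.
have /rowP/(_ (rshift s (widen_ord hr i))) := k0.
rewrite summxE (bigD1 i) // mxE -tnth_nth tnth_mktuple !mxE !eqxx mulr1 => <-.
rewrite big1 => [|j ji]; first by rewrite /= addr0.
rewrite mxE -tnth_nth tnth_mktuple mxE eqxx /= eq_rshift -val_eqE /= val_eqE eq_sym.
by rewrite (negPf ji) mulr0.
Qed.

Lemma delta_lift_directions (j : 'I_p) : (j < r)%N ->
  delta_mx 0 (rshift s j) \in lift_directions.
Proof.
move=> jr; apply/tnthP; exists (Ordinal jr); rewrite tnth_mktuple.
by congr (delta_mx _ (rshift _ _)); apply: val_inj.
Qed.

(** The sum is direct because [lsubmx] kills the added unit vectors and inverts
    [embed]. *)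
Lemma dim_embed_lift_directions (U : {vspace 'rV[R]_s}) :
  \dim (embed @: U + <<lift_directions>>) = (\dim U + r)%N.
Proof.
pose base : 'Hom('rV[R]_(s + p), 'rV[R]_s) := linfun (@lsubmx R 1 s p).
rewrite dimv_disjoint_sum; last first.
  apply/eqP; rewrite -subv0; apply/subvP => _ /memv_capP[/memv_imgP[u _ ->]].
  have : (<<lift_directions>> <= lker base)%VS.
    apply/span_subvP => _ /tnthP[j ->]; rewrite memv_ker lfunE tnth_mktuple.
    by apply/eqP/rowP => i; rewrite !mxE eq_lrshift.
  move=> /subvP sub /sub; rewrite memv_ker lfunE embedE /= row_mxKl memv0.
  by move=> /eqP ->; rewrite row_mx0.
congr (_ + _)%N; last first.
  by have /eqP -> := lift_directions_free; rewrite size_tuple.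
apply: limg_dim_eq; apply/eqP; rewrite -subv0; apply/subvP => u /memv_capP[_].
rewrite memv_ker embedE => /eqP u0.
by rewrite memv0 -(row_mxKl u (0 : 'rV_p)) u0 linear0.
Qed.

Section Points.
Variables (m : nat) (x : 'I_m -> 'rV[R]_s) (w : 'I_p -> 'I_s) (i0 : 'I_m).
Hypothesis x_neq0 : forall j : 'I_p, (j < r)%N -> exists i, x i 0 (w j) != 0.
Hypothesis x_eq0 : forall j : 'I_p, (r <= j)%N -> forall i, x i 0 (w j) = 0.

Definition lifted_family (t : 'I_m * {set 'I_p}) : 'rV[R]_(s + p) :=
  lifted_point w (x t.1) t.2.

Lemma lifted_family0 i : lifted_family (i, finset.set0) = embed (x i).
Proof. by rewrite /lifted_family /lifted_point big_set0 addr0 embedE. Qed.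

(** The generator for J = {j} minus the one for J empty, both over the same
    point x_i, is the multiple x_i(w_j) of a unit vector: it spans the new
    direction j if x_i(w_j) != 0 for some i, and nothing otherwise. *)
Lemma span_lifted_family :
  <<differences lifted_family (i0, finset.set0)>>%VS =
  (embed @: <<differences x i0>> + <<lift_directions>>)%VS.
Proof.
have diff_mem t : lifted_family t - lifted_family (i0, finset.set0) \in
    <<differences lifted_family (i0, finset.set0)>>%VS.
  by apply: memv_span; apply: map_f; rewrite mem_enum.
apply/eqP; rewrite eqEsubv; apply/andP; split.
  apply/span_subvP => _ /mapP[[i J] _ ->].
  rewrite lifted_family0 /lifted_family /lifted_point -embedE addrAC -linearB /=.
  apply: memv_add.
    by apply: memv_img; apply: memv_span; apply: map_f; rewrite mem_enum.
  apply: rpred_sum => j _; have [rj|jr] := leqP r j; first by rewrite x_eq0 // scale0r mem0v.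
  by apply: rpredZ; apply: memv_span; apply: delta_lift_directions.
rewrite subv_add limg_span; apply/andP; split; apply/span_subvP.
  move=> _ /mapP[_ /mapP[i _ ->] ->].
  by rewrite linearB /= -!lifted_family0.
move=> _ /tnthP[j ->]; rewrite tnth_mktuple; set j' := widen_ord hr j.
have [i xi] := x_neq0 (j := j') (ltn_ord j).
have -> : delta_mx 0 (rshift s j') = (x i 0 (w j'))^-1 *:
    ((lifted_family (i, finset.set1 j') - lifted_family (i0, finset.set0)) -
     (lifted_family (i, finset.set0) - lifted_family (i0, finset.set0))).
  rewrite opprB addrA subrK lifted_family0 embedE /lifted_family /lifted_point /=.
  by rewrite big_set1 addrC addKr scalerA mulVf // scale1r.
by rewrite rpredZ // rpredB.
Qed.
End Points.
End Lifting.

Theorem proposition4p8 (R : realType) (s p m r : nat)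
    (v : 'I_m -> 'rV[nat]_s) (w : 'I_p -> 'I_s)
    (hm : (0 < m)%N) (hr : (r <= p)%N)
    (hnz : forall j : 'I_p, (j < r)%N ->
       exists2 x : 'rV[R]_s, lattice_polytope R v x & x 0 (w j) != 0)
    (hz : forall j : 'I_p, (r <= j)%N ->
       forall x : 'rV[R]_s, lattice_polytope R v x -> x 0 (w j) = 0) :
  polytope_dim (weight_lifting_polytope R w v)
    = (polytope_dim (lattice_polytope R v) + r)%N
  /\ forall E : {poly rat},
       is_ehrhart_polynomial (weight_lifting_polytope R w v) E ->
       size E = (polytope_dim (weight_lifting_polytope R w v)).+1.
Proof.
pose x i := real_point R (v i).
pose i0 := Ordinal hm.
have -> : weight_lifting_polytope R w v = conv_hull (range (lifted_family x w)).
  congr conv_hull; apply/seteqP; split.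
    by move=> _ [i [J ->]]; exists (i, J).
  by move=> _ [[i J] _ <-]; exists i, J.
have x_neq0 (j : 'I_p) : (j < r)%N -> exists i, x i 0 (w j) != 0.
  move=> /hnz[y Py]; apply: contra_neqP => /forallNP x0.
  move: y Py; apply: conv_hull_coord_eq0 => _ [i _ <-].
  by have /negP := x0 i; rewrite negbK => /eqP.
have x_eq0 (j : 'I_p) : (r <= j)%N -> forall i, x i 0 (w j) = 0.
  by move=> rj i; apply: hz => // A [_]; apply; exists i.
split.
  rewrite /polytope_dim (direction_conv_hull _ (i0, finset.set0)).
  rewrite (direction_conv_hull _ i0) (span_lifted_family hr i0 x_neq0 x_eq0).
  exact: dim_embed_lift_directions.
apply: (size_ehrhart_polynomial (i0, finset.set0)) => t k.
rewrite /lifted_family /lifted_point.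
have xint l : x t.1 0 l \is a Num.int by rewrite mxE natr_int.
rewrite mxE rpredD //.
  by rewrite mxE; case: fintype.split => l; [exact: xint | rewrite mxE rpred0].
by rewrite summxE rpred_sum // => j _; rewrite !mxE rpredM // natr_int.
Qed.
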